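(* Let $f$ be an endomorphism of $(\mathbb{Q},\leqslant)$ and write $X=\operatorname{im} f$. Then: (i) if $|X|=1$, the $\mathscr{D}$-class of $f$ in $\operatorname{End}(\mathbb{Q},\leqslant)$ is a single $\mathscr{R}$-class; (ii) if $|X|>1$, the $\mathscr{D}$-class of $f$ in $\operatorname{End}(\mathbb{Q},\leqslant)$ contains $2^{\aleph_0}$ many $\mathscr{R}$-classes.
   Context: $M=\operatorname{End}(\mathbb{Q},\leqslant)$ is the monoid, under composition, of all maps $f\colon\mathbb{Q}\to\mathbb{Q}$ such that $u\leqslant v$ implies $uf\leqslant vf$. Maps are written on the right, so $fg$ means first $f$, then $g$. Green's relations on $M$: $f\,\mathscr{L}\,g$ iff $Mf=Mg$; $f\,\mathscr{R}\,g$ iff $fM=gM$; $\mathscr{D}=\mathscr{L}\circ\mathscr{R}$ (an equivalence relation, each class of which is a union of $\mathscr{R}$-classes). *)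

(* Defs.v *)
From HB Require Import structures.
From mathcomp Require Import all_boot all_order all_algebra.
From mathcomp Require Import boolp classical_sets functions cardinality.

Set Implicit Arguments.
Unset Strict Implicit.
Unset Printing Implicit Defensive.

Local Open Scope classical_set_scope.
Local Open Scope card_scope.

Reserved Notation "A '#<' B" (at level 79, format "A  '#<'  B").

Definition card_lt T U (A : set T) (B : set U) :=
  (A #<= B) && ~~ (B #<= A).
Notation "A '#<' B" := (card_lt A B) : card_scope.

Definition endo d (T : porderType d) : Type := {omorphism T -> T}.

Section EndoMonoid.
Context d (T : porderType d).

HB.instance Definition _ := gen_eqMixin (endo T).
HB.instance Definition _ := gen_choiceMixin (endo T).

Lemma endoP (f g : endo T) : (f : T -> T) =1 g -> f = g.
Proof.
case: f g => [f [[f_le]]] [g [[g_le]]] /= /funext fg.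
by case: _ / fg in g_le *; rewrite (Prop_irrelevance f_le g_le).
Qed.

(* Maps act on the right: f * g is "first f, then g". *)
Definition endo_mul (f g : endo T) : endo T := g \o f.
Definition endo_one : endo T := idfun.

Lemma endo_mulA : associative endo_mul.
Proof. by move=> f g h; apply: endoP. Qed.
Lemma endo_mul1g : left_id endo_one endo_mul.
Proof. by move=> f; apply: endoP. Qed.
Lemma endo_mulg1 : right_id endo_one endo_mul.
Proof. by move=> f; apply: endoP. Qed.

HB.instance Definition _ :=
  isMonoid.Build (endo T) endo_mulA endo_mul1g endo_mulg1.

Lemma endo_mulE (f g : endo T) x : (f * g)%g x = g (f x).
Proof. by []. Qed.

End EndoMonoid.

Section Green.
Context (M : monoidType).
Implicit Types f g : M.

Definition left_ideal f : set M := range (fun h => h * f)%g.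
Definition right_ideal f : set M := range (fun h => f * h)%g.

Definition greenL f g : Prop := left_ideal f = left_ideal g.
Definition greenR f g : Prop := right_ideal f = right_ideal g.
Definition greenD f g : Prop := exists2 h, greenL f h & greenR h g.

Definition R_class f : set M := [set g | greenR f g].
Definition D_class f : set M := [set g | greenD f g].

Definition R_classes : set (set M) := range R_class.

End Green.

(* Main.v *)
(* Endomorphisms of a chain with the same image are L-related, and R-related
   endomorphisms have the same kernel. If f u < f v, it therefore suffices to
   find continuum many h with the image of f and distinct kernels. Take a
   strictly increasing rational sequence p bounded by 1, with limit r, and let
   h = f o b where b maps the rationals below r onto {y | f y < f v} by
   interpolating between p and a cofinal sequence of that set, is constantly v
   on [r, 1], and translates [1, oo) onto [v, oo). The kernel class of 1 under h
   starts exactly at r, so it determines r; r is an arbitrary sum of digits 1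
   and 2 in base 4. *)
From HB Require Import structures.
Require Import Defs.
From mathcomp Require Import all_boot all_order all_algebra.
From mathcomp Require Import boolp classical_sets functions cardinality.
From mathcomp Require Import lra.

Local Open Scope classical_set_scope.
Local Open Scope card_scope.

(** * Green's relations in the endomorphism monoid *)

Section Green.
Local Open Scope order_scope.
Import Order.TTheory.

Lemma homo_endo {d} {T : porderType d} {b : T -> T} :
  {homo b : x y / x <= y} -> exists e : endo T, e =1 b.
Proof.
move=> b_homo; pose B := Order.isOrderMorphism.Build _ _ _ _ b b_homo.
by exists (HB.pack_for (endo T) b B).
Qed.

(** For a choice [s] of preimages under [h], [f] is [s \o f] followed by [h]. Since the order is
    total, a descent of [s \o f] at a strict ascent of [f] would make [h] reverse the order. *)
Lemma left_idealS {d} {T : orderType d} {f h : endo T} :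
  range f `<=` range h -> left_ideal f `<=` left_ideal h.
Proof.
move=> fh; have /choice[s hs] : forall y, exists x, y \in range h -> h x = y.
  move=> y; case: (pselect (range h y)) => [[x _ <-]|hNy]; first by exists x.
  by exists y => /set_mem.
have hsf x : h (s (f x)) = f x by rewrite hs//; apply/mem_set/fh; exists x.
have sf_homo : {homo s \o f : x y / x <= y}.
  move=> x y xy /=; have := omorph_le f xy.
  rewrite le_eqVlt => /orP[/eqP->//|fxy]; rewrite leNgt; apply/negP => /ltW.
  by move/(omorph_le h); rewrite !hsf leNgt fxy.
have [a aE] := homo_endo sf_homo.
move=> _ [k _ <-]; exists (k * a)%g => //; apply: endoP => x.
by rewrite !endo_mulE aE /= hsf.
Qed.

Lemma greenL_range {d} {T : orderType d} {f h : endo T} :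
  range f = range h -> greenL f h.
Proof. by move=> fh; apply/seteqP; split; apply: left_idealS; rewrite fh. Qed.

Lemma greenR_ker {d} {T : porderType d} {g h : endo T} {x y : T} :
  greenR g h -> g x = g y -> h x = h y.
Proof.
move=> gh gxy.
have [c _ <-] : right_ideal g h by rewrite gh; exists 1%g; rewrite // mulg1.
by rewrite !endo_mulE gxy.
Qed.

(** Here [a * f = f] for every [a], so the L-class of [f] is trivial. *)
Lemma const_greenD_eq {d} {T : porderType d} {f : endo T} :
  (forall x y, f x = f y) -> D_class f = R_class f.
Proof.
move=> fC; apply/seteqP; split => g; last by exists f.
move=> [h fh hg]; suff -> : f = h by [].
have [a _ <-] : left_ideal f h by rewrite fh; exists 1%g; rewrite // mul1g.
by apply: endoP => x; rewrite endo_mulE.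
Qed.

Lemma R_class_subD (M : monoidType) (f h : M) :
  greenL f h -> R_class h `<=` D_class f.
Proof. by move=> fh g hg; exists h. Qed.

Lemma eq_R_class (M : monoidType) (g h : M) : R_class g = R_class h -> greenR g h.
Proof. by move=> gh; have : R_class h h by []; rewrite -gh. Qed.

End Green.

(** * Piecewise linear interpolation *)

Section Interpolation.
Local Open Scope ring_scope.
Import Order.TTheory GRing.Theory Num.Theory.
Context {K : realFieldType}.
Implicit Types (p l : nat -> K) (x y : K).

Definition clamp01 x : K := Num.max 0 (Num.min 1 x).

Lemma clamp01_homo : {homo clamp01 : x y / x <= y}.
Proof.
by move=> x y xy; rewrite /clamp01 ge_max !le_max lexx /= le_min !ge_min lexx xy !orbT.
Qed.

Lemma clamp01_le0 x : x <= 0 -> clamp01 x = 0.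
Proof. by move=> x0; apply/max_idPl; rewrite ge_min x0 orbT. Qed.

Lemma clamp01_ge1 x : 1 <= x -> clamp01 x = 1.
Proof. by move=> x1; rewrite /clamp01 (min_idPl x1); apply/max_idPr. Qed.

Lemma clamp01_id x : 0 <= x <= 1 -> clamp01 x = x.
Proof. by case/andP=> x0 x1; rewrite /clamp01 (min_idPr x1); apply/max_idPr. Qed.

(* The graph is the half-line of slope 1 ending at (p 0, l 0), followed by the
   segments joining the points (p i, l i) for i <= n, then constant. *)
Fixpoint interp p l n x : K :=
  if n is m.+1
  then interp p l m x + clamp01 ((x - p m) / (p n - p m)) * (l n - l m)
  else l 0%N + Num.min 0 (x - p 0%N).

Context {p l : nat -> K}.
Hypotheses (p_lt : forall n, p n < p n.+1) (l_le : forall n, l n <= l n.+1).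

Lemma nodes_le n m : (n <= m)%N -> p n <= p m.
Proof.
apply: (homo_leq (r := <=%R)) => [//|y x z|i]; first exact: le_trans.
exact/ltW/p_lt.
Qed.

Lemma interp_homo n : {homo interp p l n : x y / x <= y}.
Proof.
elim: n => [|n IH] x y xy /=.
  by rewrite lerD2l le_min !ge_min lexx /= lerD2r xy orbT.
rewrite lerD ?IH// ler_wpM2r ?subr_ge0//; apply: clamp01_homo.
by rewrite ler_pM2r ?invr_gt0 ?subr_gt0// lerD2r.
Qed.

Lemma interp_ge n x : p n <= x -> interp p l n x = l n.
Proof.
elim: n => [|n IH] /= px; first by rewrite (min_idPl _) ?addr0 ?subr_ge0.
rewrite IH ?(le_trans (ltW (p_lt n)))// clamp01_ge1; first by rewrite mul1r; lra.
by rewrite ler_pdivlMr ?subr_gt0// mul1r lerD2r.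
Qed.

(** Left of its starting point a segment contributes 0. *)
Lemma interp_stable n m x : (n <= m)%N -> x <= p n -> interp p l m x = interp p l n x.
Proof.
move=> nm xp; elim: m nm => [|m IH]; first by rewrite leqn0 => /eqP->.
rewrite leq_eqVlt => /predU1P[->//|nm]; rewrite /= IH// clamp01_le0 ?mul0r ?addr0//.
have xm : x <= p m := le_trans xp (nodes_le n m nm).
by rewrite pmulr_lle0 ?invr_gt0 ?subr_gt0// subr_le0.
Qed.

Lemma interp_surj n y : y <= l n -> exists2 x, x <= p n & interp p l n x = y.
Proof.
elim: n => [|n IH] yl.
  exists (p 0%N + (y - l 0%N)); first by lra.
  by rewrite /= (min_idPr _); lra.
have [/IH[x xp <-]|ly] := leP y (l n).
  by exists x; [exact: le_trans xp (ltW (p_lt n))|exact: interp_stable].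
have lS : 0 < l n.+1 - l n by lra.
have pS : 0 < p n.+1 - p n by rewrite subr_gt0.
(* The relative height of [y] on the last segment; the preimage lies at the same relative
   position. *)
pose t := (y - l n) / (l n.+1 - l n).
have t0 : 0 <= t by rewrite divr_ge0; lra.
have t1 : t <= 1 by rewrite ler_pdivrMr// mul1r; lra.
exists (p n + t * (p n.+1 - p n)); first by nra.
rewrite /= interp_ge; last by nra.
rewrite [_ + _ - _]addrC addKr mulfK ?gt_eqF// clamp01_id ?t0//.
by rewrite /t divfK ?gt_eqF//; lra.
Qed.

(** Below the cut made by [p], [b] is the common value of the interpolations, so the index picked by
    [cid] does not matter. The cut is given by [D], as the limit of [p] need not exist in [K]. *)
Lemma cut_map (q v : K) :
    (forall n, p n <= q) -> (forall n, l n <= v) ->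
  exists b : K -> K,
  [/\ {homo b : x y / x <= y},
      forall x n, x < p n -> exists m, b x <= l m,
      forall x, x <= q -> (forall n, p n <= x) -> b x = v,
      forall y n, y <= l n -> exists x, b x = y
    & forall y, v <= y -> exists x, b x = y].
Proof.
move=> pq lv; pose D x := exists n, x < p n.
pose b x := if pselect (D x) is left Dx then interp p l (projT1 (cid Dx)) x
            else Num.max v (x - q + v).
have bD x n : x <= p n -> b x = interp p l n x.
  move=> xn; have xn1 := le_lt_trans xn (p_lt n).
  rewrite /b; case: pselect => [Dx|[]]; last by exists n.+1.
  case: cid => m /= /ltW xm.
  by case: (leqP n m) => [|/ltnW] nm; [|symmetry]; apply: interp_stable.
have bN x : ~ D x -> b x = Num.max v (x - q + v).
  by rewrite /b; case: pselect.
have b_le x n : x < p n -> b x <= l n.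
  by move=> /ltW xn; rewrite (bD _ n)// -(interp_ge n (p n))// interp_homo.
have notD x : (forall n, p n <= x) -> ~ D x.
  by move=> px [n]; rewrite ltNge px.
exists b; split.
- move=> x y xy; have [[n yn]|/[dup] NDy /bN->] := pselect (D y).
    by rewrite !(bD _ n) ?interp_homo// ltW// (le_lt_trans xy).
  have [[n xn]|/bN->] := pselect (D x).
    by rewrite le_max (le_trans (b_le _ _ xn)).
  by rewrite ge_max !le_max lexx /= lerD2r lerD2r xy orbT.
- by move=> x n /b_le; exists n.
- by move=> x xq /notD /bN ->; apply/max_idPl; lra.
- by move=> y n /interp_surj[x xn <-]; exists x; exact: bD.
- move=> y vy; exists (y - v + q); rewrite bN; first by rewrite (max_idPr _); lra.
  by apply: notD => n; have := pq n; lra.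
Qed.

End Interpolation.

(** * Cuts of the rationals coding sets of naturals *)

Section Cuts.
Local Open Scope ring_scope.
Import Order.TTheory GRing.Theory Num.Theory.

Lemma cofinal_seq {d} {T : orderType d} {e : nat -> T} {L : set T} {u : T} :
    (forall y, exists n, e n = y) -> L u ->
  exists l : nat -> T,
  [/\ forall n, (l n <= l n.+1)%O, forall n, L (l n)
    & forall y, L y -> exists n, (y <= l n)%O].
Proof.
move=> e_surj Lu.
(* The running maximum of [u] and the enumerated elements of [L]. *)
pose l := fix l n := if n is m.+1 then
  if `[<L (e m)>] then Order.max (l m) (e m) else l m else u.
exists l; split => [n|n|y] /=.
- by case: asboolP => // _; rewrite le_max lexx.
- elim: n => //= n IH; case: asboolP => // Le.
  by case: leP.
- have [n <-] := e_surj y => Le; exists n.+1 => /=.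
  by case: asboolP => // _; rewrite le_max lexx orbT.
Qed.

Lemma rat_enum : exists e : nat -> rat, forall y, exists n, e n = y.
Proof.
by exists (fun n => odflt 0 (unpickle n)) => y; exists (pickle y); rewrite pickleK.
Qed.

Lemma greenL_with_cut (f : endo rat) (u v : rat) (p : nat -> rat) (q : rat) :
    f u < f v -> (forall n, p n < p n.+1) -> (forall n, p n <= q) ->
  exists2 h : endo rat, greenL f h &
    forall x, x <= q -> h x = h q <-> (forall n, p n <= x).
Proof.
move=> fuv p_lt pq; have [e e_surj] := rat_enum.
(* Taking [f x < f v] instead of [x < v] keeps [h] strictly below [f v] before the cut. *)
have [l [l_le lL l_cof]] := cofinal_seq (L := [set x | f x < f v]) e_surj fuv.
have lv n : l n <= v.
  rewrite leNgt; apply/negP => /ltW /(omorph_le f).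
  by rewrite leNgt lL.
have [b [b_homo bD bN b_surjl b_surjv]] := cut_map p_lt l_le q v pq lv.
have [k kE] := homo_endo b_homo.
exists (k * f)%g => [|x xq].
  apply: greenL_range; apply/seteqP; split => [_ [y _ <-]|_ [x _ <-]]; last first.
    by exists (k x).
  have [/l_cof[n /b_surjl[x <-]]|] := ltP (f y) (f v).
    by exists x; rewrite // endo_mulE kE.
  have [vy _|/ltW /(omorph_le f) yv vy] := leP v y.
    by have [x <-] := b_surjv y vy; exists x; rewrite // endo_mulE kE.
  (* Now [y < v] and [f y = f v]: [b] need not attain [y], but a preimage of [v] serves. *)
  have [x xv] := b_surjv v (lexx _); exists x => //.
  by rewrite endo_mulE kE xv; apply/le_anti; rewrite vy.
rewrite !endo_mulE !kE (bN q)//; split => [fbx n|px]; last by rewrite bN.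
rewrite leNgt; apply/negP => /bD[m /(omorph_le f)].
by rewrite fbx leNgt lL.
Qed.

(* Digits 1 and 2 keep the sequence strictly increasing while the
   digit still records whether n belongs to S. *)
Fixpoint digit_sum (S : set nat) n : rat :=
  if n is m.+1 then digit_sum S m + (1 + (m \in S)%:R) / 4 ^+ n else 0.

Lemma digit_sum_lt S n : digit_sum S n < digit_sum S n.+1.
Proof. by rewrite /= ltrDl divr_gt0 ?exprn_gt0// ltr_wpDr. Qed.

Lemma digit_sum_tail S n m : (n <= m)%N -> digit_sum S m <= digit_sum S n + 1 / 4 ^+ n.
Proof.
(* This strengthening is inductive: a digit is at most 2, and 2 + 1 <= 4. *)
move=> nm; suff : digit_sum S m + 1 / 4 ^+ m <= digit_sum S n + 1 / 4 ^+ n.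
  by apply: le_trans; rewrite lerDl divr_ge0 ?exprn_ge0.
elim: m nm => [|m IH]; first by rewrite leqn0 => /eqP->.
rewrite leq_eqVlt => /predU1P[->//|/IH]; apply: le_trans => /=.
rewrite -addrA lerD2l exprS invfM.
have : 0 < (4 ^+ m : rat)^-1 by rewrite invr_gt0 exprn_gt0.
by case: (m \in S) => /=; lra.
Qed.

Lemma digit_sum_le1 S n : digit_sum S n <= 1.
Proof. by have := digit_sum_tail S 0 n isT; rewrite expr0 divr1 add0r. Qed.

(** At [n] the digit of [S] exceeds that of [S'] by one, and this unit outweighs the whole tail of
    [S']. *)
Lemma digit_sum_sep S S' n :
    (forall m, (m < n)%N -> (m \in S) = (m \in S')) -> n \in S -> n \notin S' ->
  forall m, digit_sum S' m <= digit_sum S n.+1.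
Proof.
move=> SS' nS nS' m.
have eqn : digit_sum S n = digit_sum S' n.
  elim: n SS' {nS nS'} => //= n IH SS'; rewrite IH ?SS'// => k kn.
  by rewrite SS'// ltnW.
have Sn : digit_sum S' n.+1 + 1 / 4 ^+ n.+1 = digit_sum S n.+1.
  by rewrite /= eqn nS (negPf nS') -addrA -mulrDl.
rewrite -Sn; have [/digit_sum_tail//|/ltnW mn] := leqP n.+1 m.
apply: le_trans (_ : digit_sum S' n.+1 <= _).
  exact: (nodes_le (digit_sum_lt S')).
by rewrite lerDl divr_ge0 ?exprn_ge0.
Qed.

(** At the least difference [n], the partial sum to [n.+1] of the set containing [n] bounds all sums
    of the other set, but not its own next one. *)
Lemma digit_sum_inj S S' :
    (forall x, x <= 1 -> (forall n, digit_sum S n <= x) <-> (forall n, digit_sum S' n <= x)) ->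
  S = S'.
Proof.
move=> SS'; apply: contrapT => neqS.
have [n nN nmin] : exists2 n, (n \in S) != (n \in S') &
    forall m, (m < n)%N -> (m \in S) = (m \in S').
  have ex : exists n, (n \in S) != (n \in S').
    apply: contrapT => nex; apply/neqS/seteqP.
    by split=> n /mem_set nS; apply/set_mem; apply: contrapT => /negP nS';
       apply: nex; exists n; rewrite nS (negPf nS').
  case: (ex_minnP ex) => n nN nmin; exists n => // m mn.
  by apply/eqP; apply: contraTT mn => /nmin; rewrite -leqNgt.
have absurd A B : (forall m, (m < n)%N -> (m \in A) = (m \in B)) ->
    n \in A -> n \notin B ->
    ~ ((forall m, digit_sum B m <= digit_sum A n.+1) -> forall m, digit_sum A m <= digit_sum A n.+1).
  move=> AB nA nB /(_ (digit_sum_sep _ _ _ AB nA nB) n.+2).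
  by rewrite leNgt digit_sum_lt.
case nS : (n \in S); case nS' : (n \in S') => //; move: nN; rewrite nS nS' // => _.
- by apply: (absurd S S' nmin nS _ (SS' _ (digit_sum_le1 _ _)).2); rewrite nS'.
- apply: (absurd S' S _ nS' _ (SS' _ (digit_sum_le1 _ _)).1); rewrite ?nS// => m /nmin.
  by move=> ->.
Qed.

End Cuts.

(** There are at most as many classes as endomorphisms, and an endomorphism is determined by its
    graph, coded as a set of naturals. *)
Lemma R_classes_card_le {d} {T : porderType d} :
  countable [set: T] -> @R_classes (endo T) #<= [set: set nat].
Proof.
move=> /countable_injP[c /in2TT c_inj].
apply: card_le_trans (card_image_le _ _) _; apply/pcard_injP.
pose graph (f : endo T) := [set pickle (c x, c (f x)) | x in [set: T]].
exists graph => f g _ _ fg; apply: endoP => x.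
have : graph f (pickle (c x, c (f x))) by exists x.
by rewrite fg => -[y _ /(pcan_inj pickleK)[/c_inj-> /c_inj->]].
Qed.

Theorem theorem3p7 (f : endo rat) :
  (range f #= `I_1 -> R_classes (D_class f)) /\
  (`I_1 #< range f ->
     [set C | R_classes C /\ C `<=` D_class f] #= [set: set nat]).
Proof.
split => [/pcard_eqP/unsquash g|/andP[_ fN]].
  exists f => //; apply/esym/const_greenD_eq => x y.
  have g0 z : g (f z) = 0%N.
    by apply/eqP; rewrite -leqn0 -ltnS; apply: 'funS_g; exists z.
  by apply: 'inj_g; rewrite ?inE//; exact: etrans (g0 x) (esym (g0 y)).
have [u [v fuv]] : exists u v, (f u < f v)%R.
  apply: contrapT => nex; move/negP: fN; apply.
  have fC x : f x = f 0%R.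
    by have [fx|fx|//] := Order.TotalTheory.ltgtP (f x) (f 0%R);
       case: nex; do 2!eexists; exact: fx.
  apply: card_le_trans (subset_card_le (_ : _ `<=` [set f 0%R])) _.
    by move=> _ [x _ <-]; rewrite fC.
  by have /card_eqPle[] := @card_set1 _ (f 0%R).
apply/card_eqPle; split.
  apply: card_le_trans (R_classes_card_le (T := rat) _); last exact: countableP.
  by apply: subset_card_le => C [].
have /choice[h hP] : forall S, exists h : endo rat, greenL f h /\
    (forall x, (x <= 1)%R -> h x = h 1%R <-> forall n, (digit_sum S n <= x)%R).
  move=> S; have [h] := greenL_with_cut f u v _ 1%R fuv (digit_sum_lt S) (digit_sum_le1 S).
  by exists h.
have h_inj : {in [set: set nat] &, injective (fun S => R_class (h S))}.
  (* Equal kernels give the same points [x <= 1] identified with 1, hence the same upper bounds of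
     the digit sums. *)
  move=> S S' _ _ /eq_R_class hSS'; apply: digit_sum_inj => x x1.
  rewrite -(hP S).2// -(hP S').2//; split; first exact: greenR_ker.
  exact/greenR_ker/esym.
apply: card_le_trans (subset_card_le (_ : (fun S => R_class (h S)) @` [set: set nat] `<=` _)).
  by have /card_eqPle[] := card_esym (inj_card_eq h_inj).
by move=> _ [S _ <-]; split; [exists (h S)|exact/R_class_subD/(hP S).1].
Qed.
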